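(* For every integer $t\geq 2$ and all integers $n\geq 6$, $$\operatorname{ex}_2(M(K_{2,t});n)=\Theta_t(2^{n/2});$$ that is, for every integer $t\geq 2$ there are constants $c,C>0$ depending only on $t$ such that $c\,2^{n/2}\leq \operatorname{ex}_2(M(K_{2,t});n)\leq C\,2^{n/2}$ for all integers $n\geq 6$.
   Context: A matroid is simple if it has no loops and no two distinct parallel elements. A matroid is binary ($\operatorname{GF}(2)$-representable) if it is isomorphic to the vector matroid of a finite family of vectors over the field with $2$ elements. For matroids $M$ and $N$, $M$ has an $N$-restriction if $M|X\cong N$ for some $X\subseteq E(M)$. $M(G)$ denotes the cycle matroid of a graph $G$, and $K_{s,t}$ is the complete bipartite graph with parts of sizes $s$ and $t$. For a nonempty simple binary matroid $N$, $\operatorname{ex}_2(N;n)$ is the maximum number of elements in a rank-$n$ simple binary matroid with no $N$-restriction. *)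

(* Defs.v *)
From HB Require Import structures.
From mathcomp Require Import all_boot all_order all_algebra.
From mathcomp Require Import boolp reals exp.
From mathcomp Require classical_sets.

Set Implicit Arguments.
Unset Strict Implicit.
Unset Printing Implicit Defensive.

Import GRing.Theory.
Local Open Scope ring_scope.

(* The ground set of a matroid is the whole finite type T. *)
Record matroid (T : finType) := Matroid {
  indep : pred {set T};
  indep_set0 : indep set0;
  indep_sub : forall A B : {set T}, A \subset B -> indep B -> indep A;
  indep_augment : forall A B : {set T}, indep A -> indep B ->
    (#|A| < #|B|)%N -> exists2 x, x \in B :\: A & indep (x |: A)
}.

Definition matroid_iso (S T : finType) (M : matroid S) (N : matroid T) : Prop :=
  exists2 f : S -> T, bijective f &
    forall A : {set S}, indep N (f @: A) = indep M A.

Section Matroid.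
Variables (T : finType) (M : matroid T).

Definition matroid_rank : nat := \max_(A : {set T} | indep M A) #|A|.

Definition is_loop (x : T) : bool := ~~ indep M [set x].

Definition are_parallel (x y : T) : bool :=
  [&& ~~ is_loop x, ~~ is_loop y & ~~ indep M [set x; y]].

Definition simple_matroid : Prop :=
  (forall x, ~~ is_loop x) /\ (forall x y, x != y -> ~~ are_parallel x y).

End Matroid.

Section Restriction.
Variables (T : finType) (M : matroid T) (X : {set T}).
Let sX : finType := {x : T | x \in X}.

Definition restr_indep : pred {set sX} :=
  fun A => indep M [set val a | a in A].

Fact restr_indep_set0 : restr_indep set0.
Proof. by rewrite /restr_indep imset0 indep_set0. Qed.

Fact restr_indep_sub (A B : {set sX}) :
  A \subset B -> restr_indep B -> restr_indep A.
Proof. by move=> sAB; apply: indep_sub; apply: imsetS. Qed.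

Fact restr_indep_augment (A B : {set sX}) :
  restr_indep A -> restr_indep B -> (#|A| < #|B|)%N ->
  exists2 x, x \in B :\: A & restr_indep (x |: A).
Proof.
move=> iA iB ltAB.
case: (indep_augment iA iB); first by rewrite !card_imset //; apply: val_inj.
move=> _ /setDP[/imsetP[b bB ->] bA] ibA; exists b.
  by rewrite inE bB andbT; apply: contra bA => bA; apply: imset_f.
by rewrite /restr_indep imsetU1.
Qed.

Definition matroid_restr : matroid sX :=
  Matroid restr_indep_set0 restr_indep_sub restr_indep_augment.

End Restriction.

Definition has_restriction (S T : finType) (M : matroid T) (N : matroid S) :
    Prop :=
  exists X : {set T}, matroid_iso (matroid_restr M X) N.

Section VectorMatroid.
Variables (F : fieldType) (V : vectType F) (T : finType) (v : T -> V).

Definition vec_indep : pred {set T} := fun A => free [seq v x | x in A].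

Lemma vec_indepP (A : {set T}) :
  reflect (forall k : T -> F, \sum_(x in A) k x *: v x = 0 ->
             forall x, x \in A -> k x = 0)
          (vec_indep A).
Proof.
rewrite /vec_indep /image_mem; set s := [seq v x | x <- enum A].
have szs : size s = #|A| by rewrite size_map -cardE.
have sE (k : T -> F) (x0 : T) :
    \sum_(i < size s) k (nth x0 (enum A) i) *: s`_i
    = \sum_(x in A) k x *: v x.
  rewrite -(big_mkord xpredT (fun i => k (nth x0 (enum A) i) *: s`_i)).
  rewrite -[RHS]big_enum (big_nth x0) size_map.
  by apply: eq_big_nat => i /andP[_ lti]; rewrite /s (nth_map x0).
apply: (iffP (@freeP _ _ _ (in_tuple s))) => /= H k.
  move=> k0 x xA; have ltx : (index x (enum A) < size s)%N.
    by rewrite size_map index_mem mem_enum.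
  have := H (fun i => k (nth x (enum A) i)); rewrite sE => /(_ k0).
  by move=> /(_ (Ordinal ltx)) /=; rewrite nth_index ?mem_enum.
move=> k0 i.
have x0 : T by move: i => [i]; rewrite /s; case: (enum A).
pose k' x := if insub (index x (enum A)) is Some j then k j else 0.
have k'E (j : 'I_(size s)) : k' (nth x0 (enum A) j) = k j.
  rewrite /k' index_uniq ?enum_uniq //; last by rewrite -(size_map v).
  by rewrite valK.
have := H k'; rewrite -(sE k' x0).
rewrite (eq_bigr (fun j => k j *: s`_j)) => [|j _]; last by rewrite k'E.
move=> /(_ k0 (nth x0 (enum A) i)); rewrite k'E; apply.
by rewrite -mem_enum mem_nth // -(size_map v).
Qed.

Fact vec_indep_set0 : vec_indep set0.
Proof. by apply/vec_indepP => k _ x; rewrite inE. Qed.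

Fact vec_indep_sub (A B : {set T}) : A \subset B -> vec_indep B -> vec_indep A.
Proof.
move=> sAB /vec_indepP iB; apply/vec_indepP => k k0 x xA.
have := iB (fun y => if y \in A then k y else 0).
rewrite (bigID [in A]) /= [X in _ + X]big1 ?addr0; last first.
  by move=> i /andP[_ /negPf->]; rewrite scale0r.
rewrite (eq_bigl [in A]) => [|i]; last first.
  by apply/andP/idP => [[]|iA] //; rewrite (subsetP sAB).
rewrite (eq_bigr (fun y => k y *: v y)) => [|i iA]; last first.
  by rewrite [i \in A]iA.
by move=> /(_ k0 x (subsetP sAB _ xA)); rewrite xA.
Qed.

Lemma vec_indepU1 (A : {set T}) x :
  v x \notin <<[seq v y | y in A]>>%VS -> vec_indep A -> vec_indep (x |: A).
Proof.
move=> xA iA.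
have xnA : x \notin A by apply: contra xA => xA; apply/memv_span/image_f.
rewrite /vec_indep (@perm_free _ _ _ (v x :: [seq v x | x in A])).
  by rewrite free_cons xA.
rewrite -map_cons; apply/perm_map/uniq_perm; rewrite ?enum_uniq //=.
  by rewrite mem_enum xnA enum_uniq.
by move=> y; rewrite !(inE, mem_enum).
Qed.

Fact vec_indep_augment (A B : {set T}) :
  vec_indep A -> vec_indep B -> (#|A| < #|B|)%N ->
  exists2 x, x \in B :\: A & vec_indep (x |: A).
Proof.
move=> iA iB ltAB.
have /subsetPn[x xB xA] : ~~ (B \subset [set x | v x \in <<[seq v x | x in A]>>%VS]).
  apply/negP => /subsetP sBA; move: ltAB; rewrite ltnNge => /negP; apply.
  rewrite -(size_image v A) -(size_image v B).
  rewrite -(eqP (iA : \dim _ == size _)) -(eqP (iB : \dim _ == size _)).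
  by apply/dimvS/span_subvP => _ /imageP[y yB ->]; have := sBA _ yB; rewrite inE.
rewrite inE in xA; exists x; last exact: vec_indepU1.
by rewrite inE xB andbT; apply: contra xA => xA; apply/memv_span/image_f.
Qed.

Definition vector_matroid : matroid T :=
  Matroid vec_indep_set0 vec_indep_sub vec_indep_augment.

End VectorMatroid.

Definition binary_matroid (T : finType) (M : matroid T) : Prop :=
  exists (S : finType) (d : nat) (v : S -> 'rV['F_2]_d),
    matroid_iso M (vector_matroid v).

Lemma card_simple_binary (T : finType) (M : matroid T) :
  simple_matroid M -> binary_matroid M -> (#|T| <= 2 ^ matroid_rank M)%N.
Proof.
move=> [nl np] [S [d [v [f fbij fM]]]].
have [B iB rB] : exists2 B : {set T}, indep M B & matroid_rank M = #|B|.
  have [|B iB rB] := @eq_bigmax_cond _ [pred A | indep M A] (fun A => #|A|).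
    by apply/card_gt0P; exists set0; rewrite inE indep_set0.
  by exists B.
have Bmax C : indep M C -> (#|C| <= #|B|)%N.
  by move=> iC; rewrite -rB; apply: (bigmax_sup C).
pose X := in_tuple [seq v y | y in f @: B].
have vX t : v (f t) \in <<X>>%VS.
  have [tB|tB] := boolP (t \in B); first by apply/memv_span/image_f/imset_f.
  apply/negPn/negP => vt; have : indep M (t |: B).
    rewrite -fM imsetU1; apply: vec_indepU1 => //.
    by have := iB; rewrite -fM.
  by move/Bmax; rewrite cardsU1 tB add1n ltnn.
have vinj : injective (v \o f).
  move=> x y /= vxy; apply/eqP/negPn/negP => nxy.
  have nlxy z : indep M [set z] by apply/negPn; apply: nl.
  have := np _ _ nxy; rewrite /are_parallel /is_loop !nlxy /= negbK -fM.
  move=> /vec_indepP /(_ (fun z => if z == f x then 1 else -1)).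
  have nfxy : f x != f y by rewrite (inj_eq (bij_inj fbij)).
  rewrite imsetU1 imset_set1 big_setU1 ?inE // big_set1 eqxx.
  rewrite eq_sym (negPf nfxy) vxy scale1r scaleN1r => /(_ (subrr _) (f x)).
  by rewrite !inE eqxx => /(_ isT) /eqP; rewrite oner_eq0.
have szX : size X = matroid_rank M.
  by rewrite rB size_image card_imset //; apply: bij_inj.
pose c t := [ffun i => coord X i (v (f t))].
have cinj : injective c.
  move=> x y /ffunP cxy; apply: vinj => /=.
  rewrite (coord_span (vX x)) (coord_span (vX y)); apply: eq_bigr => i _.
  by have := cxy i; rewrite !ffunE => ->.
have := leq_card c cinj.
by rewrite card_ffun !card_ord (szX : size _ = _).
Qed.

(* Finite graphs, with loops and parallel edges allowed; the order of the two
   ends of an edge is irrelevant. *)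
Record graph := Graph {
  vertex : finType;
  edge : finType;
  ends : edge -> vertex * vertex
}.

Section CycleMatroid.
Variable G : graph.

Definition joins (e : edge G) (u w : vertex G) : bool :=
  (ends e == (u, w)) || (ends e == (w, u)).

(* The cycle v_1 e_1 v_2 e_2 ... v_k e_k v_1 is represented by the sequence of
   pairs (v_1, e_1), ..., (v_k, e_k); k = 1 is a loop, k = 2 a pair of parallel
   edges. *)
Definition is_cycle (p : seq (vertex G * edge G)) : bool :=
  [&& p != [::], cycle (fun d d' => joins d.2 d.1 d'.1) p,
      uniq [seq d.1 | d <- p] & uniq [seq d.2 | d <- p]].

Definition acyclic : pred {set edge G} := fun A =>
  `[< forall p, is_cycle p -> ~~ all (fun d => d.2 \in A) p >].

(* Incidence vectors over GF(2); a loop gets the zero vector. *)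
Definition incidence (e : edge G) : 'rV['F_2]_#|vertex G| :=
  delta_mx 0 (enum_rank (ends e).1) + delta_mx 0 (enum_rank (ends e).2).

Let delta (u : vertex G) : 'rV['F_2]_#|vertex G| := delta_mx 0 (enum_rank u).

Let addxx n (x : 'rV['F_2]_n) : x + x = 0.
Proof.
apply/rowP => i; rewrite !mxE -mulr2n -mulr_natr.
by rewrite (_ : 2%:R = 0) ?mulr0 //; apply/val_inj.
Qed.

Let incidenceE e u w : joins e u w -> incidence e = delta u + delta w.
Proof. by rewrite /incidence => /orP[] /eqP-> //=; rewrite addrC. Qed.

Let deltaE u w : delta u 0 (enum_rank w) = (u == w)%:R.
Proof. by rewrite mxE eqxx /= (inj_eq enum_rank_inj) eq_sym. Qed.

Let incidence_path x s :
  path (fun d d' => joins d.2 d.1 d'.1) x s ->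
  \sum_(d <- belast x s) incidence d.2 = delta x.1 + delta (last x s).1.
Proof.
elim: s x => [|y s IH] x /=; first by rewrite big_nil addxx.
move=> /andP[/incidenceE e1 /IH e2]; rewrite big_cons e1 e2.
by rewrite addrA -[_ + _ + delta y.1]addrA addxx addr0.
Qed.

Let F2P (a : 'F_2) : a != 0 -> a = 1.
Proof. by case: a => [[|[|]]] // i _; apply/val_inj. Qed.

Let sum_free (A : {set edge G}) : vec_indep incidence A -> acyclic A.
Proof.
move=> /vec_indepP iA; apply/asboolP => p /and4P[pn0 cp _ up].
apply/negP => /allP pA.
case: p => [|x s] // in pn0 cp up pA *.
have := iA (fun e => (e \in [seq d.2 | d <- x :: s])%:R).
have -> : \sum_(e in A) (e \in [seq d.2 | d <- x :: s])%:R *: incidence e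
        = \sum_(d <- x :: s) incidence d.2.
  rewrite -(big_map snd xpredT incidence) (big_uniq _ up) /=.
  rewrite (bigID [in [seq d.2 | d <- x :: s]]) /= [X in _ + X]big1 ?addr0.
    apply: eq_big => [e|e /andP[_ ->]]; last by rewrite scale1r.
    apply/andP/idP => [[]//|es]; split=> //.
    by have /mapP[d ds ->] : e \in [seq d.2 | d <- x :: s] by []; apply: pA.
  by move=> e /andP[_ /negPf->]; rewrite scale0r.
have := incidence_path cp; rewrite belast_rcons last_rcons addxx => ->.
move=> /(_ erefl x.2 (pA _ (mem_head _ _))).
by rewrite mem_head => /eqP; rewrite oner_eq0.
Qed.

Let free_acyclic (A : {set edge G}) : acyclic A -> vec_indep incidence A.
Proof.
move=> /asboolP acA; apply/vec_indepP => k k0 x xA.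
apply/eqP; apply/negPn/negP => kx0.
pose B := [set e in A | k e != 0].
have xB : x \in B by rewrite inE xA.
have BA e : e \in B -> e \in A by rewrite inE => /andP[].
have {k0} B0 : \sum_(e in B) incidence e = 0.
  rewrite -[RHS]k0 [RHS](bigID (fun e => k e != 0)) /= [X in _ + X]big1 ?addr0.
    apply: eq_big => e; first by rewrite inE.
    by rewrite inE => /andP[_ /F2P->]; rewrite scale1r.
  by move=> e /andP[_ /negPn/eqP->]; rewrite scale0r.
have noloop e u : e \in B -> joins e u u -> False.
  move=> eB eu; have cyc : is_cycle [:: (u, e)] by rewrite /is_cycle /= eu.
  by case/negP: (acA _ cyc); rewrite /= BA.
have next e u w : e \in B -> joins e u w ->
    exists f z, [/\ f \in B, f != e & joins f z u].
  move=> eB euw; have neq : u != w.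
    by apply/eqP => e1; move: euw; rewrite -e1; apply: noloop.
  pose inc f := ((ends f).1 == u) || ((ends f).2 == u).
  have [f /and3P[fB nfe fu]|none] :=
      pickP [pred f | [&& f \in B, f != e & inc f]].
    case E : (ends f) fu => [a b]; rewrite /inc E /= => /orP[]/eqP eu.
      by exists f, b; split=> //; rewrite /joins E eu eqxx orbT.
    by exists f, a; split=> //; rewrite /joins E eu eqxx.
  have := congr1 (fun M : 'rV_ _ => M 0 (enum_rank u)) B0.
  rewrite /= summxE mxE (bigD1 e) //= [X in _ + X]big1 ?addr0.
    rewrite (incidenceE euw) mxE !deltaE eqxx eq_sym (negPf neq) addr0.
    by move=> /eqP; rewrite oner_eq0.
  move=> f /andP[fB fe]; have := none f; rewrite /= fB fe /inc /=.
  move=> /negbT; rewrite negb_or => /andP[/negPf n1 /negPf n2].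
  by rewrite mxE !deltaE n1 n2 addr0.
pose good d := (d.2 \in B) && (((ends d.2).1 == d.1) || ((ends d.2).2 == d.1)).
have long m : exists u e w s,
    [/\ size s = m, path (fun d d' => joins d.2 d.1 d'.1) (u, e) s,
        uniq [seq d.1 | d <- (u, e) :: s] /\ uniq [seq d.2 | d <- (u, e) :: s],
        all good ((u, e) :: s) & joins e u w].
  elim: m => [|m [u [e [w [s [szs ps [us vs] gs euw]]]]]].
    case E : (ends x) => [a b]; exists a, x, b, [::].
    by split=> //=; rewrite /good /joins /= ?xB E eqxx.
  have eB : e \in B by move: gs => /= /andP[/andP[]].
  have [f [z [fB nfe fzu]]] := next _ _ _ eB euw.
  have gf : good (z, f).
    by rewrite /good /= fB; case/orP: fzu => /eqP-> /=; rewrite eqxx ?orbT.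
  have hd g : (u, g) \in (u, e) :: s -> g = e.
    rewrite inE => /orP[/eqP[]//|gin]; move: us => /= /andP[/negP[]].
    by apply/mapP; exists (u, g).
  have fin d : d \in (u, e) :: s -> d.2 = f -> d.1 = z.
    case: d => y g din /= gE; have /andP[_] := allP gs _ din.
    rewrite /= {g}gE in din *; have [yu|nyu] := eqVneq y u.
      have ef : f = e by apply: hd; move: din; rewrite yu.
      by rewrite ef eqxx in nfe.
    by case/orP: fzu => /eqP-> /= /orP[]/eqP yE //; rewrite yE eqxx in nyu.
  have [zin|zout] := boolP (z \in [seq d.1 | d <- (u, e) :: s]); last first.
    exists z, f, u, ((u, e) :: s); split=> //.
    - by rewrite /= szs.
    - by rewrite /= fzu.
    - split; rewrite map_cons cons_uniq; apply/andP; split=> //.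
      by apply: contra zout => /mapP[d din fE]; apply/mapP; exists d; rewrite // (fin d).
    - by apply/andP.
  case/mapP: zin => -[z' g] gin /= zE; rewrite -zE in gin.
  have [p1 [p2 Ep]] : exists p1 p2, (u, e) :: s = p1 ++ (z, g) :: p2.
    by case/splitPr: gin => p1 p2; exists p1, p2.
  have zp1 d : d \in p1 -> d.1 != z.
    move=> dp; apply/eqP => dz; move: us; rewrite Ep map_cat cat_uniq /=.
    by rewrite -dz map_f //= andbF.
  have cyc : is_cycle ((z, f) :: p1).
    apply/and4P; split=> //=.
    - move: ps; case: p1 Ep {zp1} => [[uz _ _] _|y p1 [<- ->]] /=.
        by rewrite uz in fzu; rewrite fzu.
      by rewrite fzu cat_path rcons_path /= => /and3P[-> ->].
    - move: us; rewrite Ep map_cat cat_uniq => /andP[-> _]; rewrite andbT.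
      by apply/mapP => -[d /zp1 /eqP nz /esym].
    - move: vs; rewrite Ep map_cat cat_uniq => /andP[-> _]; rewrite andbT.
      apply/mapP => -[d dp1 fE]; have /eqP[] := zp1 _ dp1.
      by apply: fin => //; rewrite Ep mem_cat dp1.
  case/negP: (acA _ cyc); rewrite /= BA //=.
  apply/allP => d dp; have : good d by apply: (allP gs); rewrite Ep mem_cat dp.
  by move=> /andP[/BA].
have [u [e [w [s [szs _ [us _] _ _]]]]] := long #|vertex G|.
have := max_card [in [seq d.1 | d <- (u, e) :: s]].
by rewrite (card_uniqP us) /= size_map szs ltnn.
Qed.

Lemma acyclicE (A : {set edge G}) : acyclic A = indep (vector_matroid incidence) A.
Proof. by apply/idP/idP => [/free_acyclic|/sum_free]. Qed.

Fact acyclic_set0 : acyclic set0.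
Proof. by rewrite acyclicE indep_set0. Qed.

Fact acyclic_sub (A B : {set edge G}) : A \subset B -> acyclic B -> acyclic A.
Proof. by rewrite !acyclicE; apply: indep_sub. Qed.

Fact acyclic_augment (A B : {set edge G}) :
  acyclic A -> acyclic B -> (#|A| < #|B|)%N ->
  exists2 x, x \in B :\: A & acyclic (x |: A).
Proof.
rewrite !acyclicE => iA iB ltAB.
by have [x] := indep_augment iA iB ltAB; rewrite -acyclicE; exists x.
Qed.

Definition cycle_matroid : matroid (edge G) :=
  Matroid acyclic_set0 acyclic_sub acyclic_augment.

End CycleMatroid.

Definition complete_bipartite (s t : nat) : graph :=
  @Graph ('I_s + 'I_t)%type ('I_s * 'I_t)%type
    (fun e => (inl e.1, inr e.2)).

Section Extremal.
Variables (S : finType) (N : matroid S) (n : nat).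

Definition ex2_witness (m : nat) : Prop :=
  exists (T : finType) (M : matroid T),
    [/\ simple_matroid M, binary_matroid M, matroid_rank M = n,
        ~ has_restriction M N & #|T| = m].

Definition ex2_spec (m : nat) : Prop :=
  ex2_witness m /\ forall m', ex2_witness m' -> (m' <= m)%N.

(* By ex2_max the maximum exists as soon as there is a witness; the value is 0
   otherwise. *)
Definition ex2 : nat := classical_sets.xget 0%N ex2_spec.

Lemma ex2_max (m : nat) : ex2_witness m -> ex2_spec ex2.
Proof.
move=> wm; apply: (@classical_sets.xgetPex nat 0%N ex2_spec).
have bound k : `[< ex2_witness k >] -> (k <= 2 ^ n)%N.
  by move/asboolP => -[T [M [sM bM <- _ <-]]]; apply: card_simple_binary.
have ex : exists k, `[< ex2_witness k >] by exists m; apply/asboolP.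
case: (ex_maxnP ex bound) => k /asboolP wk kmax.
by exists k; split=> // m' wm'; apply/kmax/asboolP.
Qed.

End Extremal.

(* Main.v *)
(* A subset of GF(2)^n contains a K_{2,t} exactly when t of its pairs {x_j, y_j}
   have a common sum d, with d, x_1, ..., x_t independent.

   Upper bound: among |A|^2 sums in a space of size 2^n, some d <> 0 is a sum of
   more than 2^t pairs once |A| is large compared to 2^(n/2), and t members of
   these pairs that are independent modulo d can be picked greedily.

   Lower bound: any four of the vectors (x, x^3), x <> 0, of GF(2^k)^2 are
   independent (the double-error-correcting BCH code), so this set has no
   K_{2,2}.  A set maximal among those whose four-element subsets are all
   independent spans the space, because a vector outside the span could be added;
   extending to such a set makes the rank exactly n. *)
Require Import Defs.
From mathcomp Require Import all_boot all_order all_algebra all_field.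
From mathcomp Require Import ring lra.
From mathcomp Require Import reals exp.

Set Implicit Arguments.
Unset Strict Implicit.
Unset Printing Implicit Defensive.

Import Order.TTheory GRing.Theory Num.Theory.
Local Open Scope ring_scope.

(** * Vector matroids, binary representations and restrictions *)

Section VectorMatroidTheory.
Variables (F : fieldType) (V : vectType F).

Lemma vec_indep_imset (S T : finType) (h : S -> T) (v : T -> V) (B : {set S}) :
  injective h -> vec_indep v (h @: B) = vec_indep (v \o h) B.
Proof.
move=> hinj; rewrite /vec_indep; apply: perm_free.
rewrite /image_mem [X in perm_eq _ X](map_comp v h); apply: perm_map; apply: uniq_perm.
- exact: enum_uniq.
- by rewrite map_inj_uniq ?enum_uniq.
- move=> y; rewrite mem_enum; apply/imsetP/mapP => -[x xB ->];
    by exists x; rewrite // ?mem_enum // -mem_enum.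
Qed.

(** Independence depends only on linear relations; coefficients on [A] are extended by zero to [S].
    No linear map between [V] and [W] has to be built. *)
Lemma vec_indep_relP (W : vectType F) (S : finType) (v : S -> V) (w : S -> W) :
  (forall k : S -> F, \sum_x k x *: v x = 0 <-> \sum_x k x *: w x = 0) ->
  vec_indep v =1 vec_indep w.
Proof.
move=> vw A.
have ext (U : vectType F) (u : S -> U) (k : S -> F) :
    \sum_(x in A) k x *: u x = \sum_x (if x \in A then k x else 0) *: u x.
  rewrite big_mkcond; apply: eq_bigr => x _.
  by case: ifP; rewrite ?scale0r.
apply/vec_indepP/vec_indepP => iA k; rewrite ext => /vw; rewrite -ext; exact: iA.
Qed.

Lemma vec_indep1 (T : finType) (v : T -> V) (x : T) :
  vec_indep v [set x] = (v x != 0).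
Proof. by rewrite /vec_indep /image_mem enum_set1 /= free_cons nil_free span_nil memv0 andbT. Qed.

Lemma vec_indep_inj2 (T : finType) (v : T -> V) (x y : T) :
  x != y -> vec_indep v [set x; y] -> v x != v y.
Proof.
move=> nxy /vec_indepP/(_ (fun z => if z == x then 1 else -1)) ixy.
apply/eqP => vxy; move: ixy; rewrite big_setU1 ?inE // big_set1 eqxx eq_sym (negPf nxy).
rewrite vxy scale1r scaleN1r => /(_ (subrr _) x); rewrite !inE eqxx => /(_ isT) /eqP.
by rewrite oner_eq0.
Qed.

(** An independent set of maximum size spans all the vectors, since one outside its span would
    enlarge it. *)
Lemma rank_vector_matroid (T : finType) (v : T -> V) (M : matroid T) :
  indep M =1 vec_indep v -> matroid_rank M = \dim <<codom v>>.
Proof.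
move=> MP; apply/eqP; rewrite eqn_leq; apply/andP; split.
  apply/bigmax_leqP => A; rewrite MP => iA; rewrite -(size_image v A).
  rewrite -(eqP (iA : \dim _ == size _)); apply/dimvS/sub_span => x.
  by move=> /imageP[y _ ->]; apply: codom_f.
have [|B iB rB] := @eq_bigmax_cond _ [pred A | indep M A] (fun A => #|A|).
  by apply/card_gt0P; exists set0; rewrite inE indep_set0.
rewrite inE MP in iB.
rewrite (rB : matroid_rank M = _) -(size_image v B) -(eqP (iB : \dim _ == size _)).
apply/dimvS/span_subvP => _ /codomP[x ->].
apply/negPn/negP => vx; have : indep M (x |: B) by rewrite MP vec_indepU1.
have xB : x \notin B by apply: contra vx => xB; apply/memv_span/image_f.
move=> ixB; have : (#|x |: B| <= matroid_rank M)%N by apply: (bigop.bigmax_sup (x |: B)).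
by rewrite [X in (_ <= X)%N](rB : matroid_rank M = _) cardsU1 xB add1n ltnn.
Qed.

End VectorMatroidTheory.

(** The representation is pulled back along the isomorphism, so that the ground set itself indexes
    the vectors. *)
Lemma binary_matroidP (T : finType) (M : matroid T) :
  binary_matroid M ->
  exists (d : nat) (v : T -> 'rV['F_2]_d), indep M =1 vec_indep v.
Proof.
move=> [S [d [v [f fbij fM]]]]; exists d, (v \o f) => A.
by rewrite -vec_indep_imset -?fM //; apply: bij_inj.
Qed.

Lemma simple_vec_indepP (T : finType) (M : matroid T) (d : nat)
    (v : T -> 'rV['F_2]_d) :
  indep M =1 vec_indep v -> simple_matroid M ->
  injective v /\ forall x, v x != 0.
Proof.
move=> MP [nl np]; split=> [x y vxy|x]; last first.
  by have := nl x; rewrite /is_loop negbK MP vec_indep1.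
apply/eqP/negPn/negP => nxy; have := np _ _ nxy.
rewrite /are_parallel !nl /= negbK MP => /(vec_indep_inj2 nxy).
by rewrite vxy eqxx.
Qed.

(** Trades the subtype of a subset for an embedding, which is easier to build and to use. *)
Lemma has_restrictionP (S T : finType) (M : matroid T) (N : matroid S) :
  has_restriction M N <->
  exists2 g : S -> T, injective g & forall B : {set S}, indep M (g @: B) = indep N B.
Proof.
split=> [[X [f [f' fK f'K] fN]]|[g ginj gN]].
  exists (val \o f'); first exact/inj_comp/(can_inj f'K)/val_inj.
  move=> B; have := fN (f' @: B); rewrite -imset_comp.
  rewrite (eq_imset (g := id)) ?imset_id // => ->.
  by rewrite /= /restr_indep; congr (indep M _); rewrite imset_comp.
pose X := g @: [set: S]; exists X.
have gX x : g x \in X by rewrite imset_f ?inE.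
pose h x : {y | y \in X} := exist _ (g x) (gX x).
have hinj : injective h by move=> x y /(congr1 val)/ginj.
have hsurj y : exists x, h x == y.
  by have [x _ yE] := imsetP (valP y); exists x; apply/eqP/val_inj.
pose f y := xchoose (hsurj y).
have fK : cancel f h by move=> y; apply/eqP/(xchooseP (hsurj y)).
have hK : cancel h f by move=> x; apply: hinj; rewrite fK.
exists f; first by exists h.
move=> A; rewrite -gN /= /restr_indep -imset_comp; congr (indep M _).
by apply: eq_imset => y; rewrite -[in RHS](fK y).
Qed.

(** * The upper bound *)

Section K2Restriction.
Variable t : nat.
Let K := complete_bipartite 2 t.

(** Each vertex gives one coordinate: a vertex on the side of size two sees its star, a vertex on
    the other side its two edges. *)
Lemma incidence_rel (k : edge K -> 'F_2) :
  \sum_e k e *: incidence e = 0 <->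
  (forall j, k (ord0, j) + k (ord_max, j) = 0) /\
  (forall i, \sum_j k (i, j) = 0).
Proof.
pose D (u : vertex K) : 'rV['F_2]_#|vertex K| := delta_mx 0 (enum_rank u).
have DE u w : D u 0 (enum_rank w) = (u == w)%:R.
  by rewrite mxE eqxx /= (inj_eq enum_rank_inj) eq_sym.
have E u : (\sum_e k e *: incidence e) 0 (enum_rank u) =
    \sum_i \sum_j k (i, j) * ((inl i == u)%:R + (inr j == u)%:R).
  rewrite summxE pair_big; apply: eq_bigr => -[i j] _.
  by rewrite mxE [X in _ * X]mxE; congr (_ * (_ + _)); apply: DE.
have El i : (\sum_e k e *: incidence e) 0 (enum_rank (inl i : vertex K)) =
    \sum_j k (i, j).
  rewrite E (bigD1 i) //= -[RHS]addr0; congr (_ + _).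
    by apply: eq_bigr => j _; rewrite eqxx addr0 mulr1.
  apply: big1 => i' ni; apply: big1 => j _.
  by rewrite [inl i' == _](negPf ni) addr0 mulr0.
have Er j : (\sum_e k e *: incidence e) 0 (enum_rank (inr j : vertex K)) =
    k (ord0, j) + k (ord_max, j).
  rewrite E exchange_big (bigD1 j) //= -[RHS]addr0; congr (_ + _).
    rewrite big_ord_recl big_ord1 eqxx add0r !mulr1; congr (_ + k (_, _)).
    exact: val_inj.
  apply: big1 => j' nj; apply: big1 => i _.
  by rewrite [inr j' == _](negPf nj) addr0 mulr0.
split=> [k0|[kr kl]].
  by split=> [j|i]; rewrite -?Er -?El k0 mxE.
apply/rowP => w; rewrite -(enum_valK w) [RHS]mxE.
by case: (enum_val w) => [i|j]; rewrite ?El ?Er.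
Qed.

Variables (V : vectType 'F_2) (x : 'I_t -> V) (d : V).
Hypothesis xd_indep : forall (c : 'I_t -> 'F_2) (b : 'F_2),
  \sum_j c j *: x j + b *: d = 0 -> (forall j, c j = 0) /\ b = 0.

Definition K2_vec (e : edge K) : V := x e.2 + (e.1 : nat)%:R *: d.

Lemma K2_vec_inj : injective K2_vec.
Proof.
move=> [i j] [i' j'] /= /eqP; rewrite -subr_eq0 /K2_vec /= => /eqP xij.
(* These are the coefficients of the difference of the two edge vectors, which therefore all
   vanish. *)
have [|cj /eqP b0] := xd_indep (c := fun l => (l == j)%:R - (l == j')%:R)
    (b := (i : nat)%:R - (i' : nat)%:R).
  have delta_sum l : \sum_m (m == l)%:R *: x m = x l.
    by rewrite (bigD1 l) //= eqxx scale1r big1 ?addr0 // => m /negPf->; rewrite scale0r.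
  rewrite -[RHS]xij scalerBl opprD addrACA; congr (_ + _).
  under eq_bigr do rewrite scalerBl.
  by rewrite sumrB !delta_sum.
have /eqP := cj j; rewrite eqxx subr_eq0; case: (j =P j') => [<- _|_]; last by rewrite oner_eq0.
congr (_, _); apply: val_inj; move: b0; rewrite subr_eq0.
by case: i i' {xij} => [[|[|]]] // ? [[|[|]]].
Qed.

(* Both sums vanish iff the entries of k cancel on every edge pair
   {(0, j), (1, j)} and sum to zero on each of the two stars. *)
Lemma K2_vec_rel (k : edge K -> 'F_2) :
  \sum_e k e *: K2_vec e = 0 <-> \sum_e k e *: incidence e = 0.
Proof.
have -> : \sum_e k e *: K2_vec e = \sum_j (k (ord0, j) + k (ord_max, j)) *: x j
    + (\sum_j k (ord_max, j)) *: d.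
  transitivity (\sum_i \sum_j k (i, j) *: (x j + (i : nat)%:R *: d)).
    by rewrite pair_big; apply: eq_bigr => -[i j].
  rewrite big_ord_recl big_ord1 -big_split scaler_suml -big_split /=.
  apply: eq_bigr => j _; rewrite scale0r addr0 scale1r scalerDr scalerDl -addrA.
  by rewrite (_ : lift ord0 ord0 = ord_max) //; apply: val_inj.
split=> [/xd_indep[cj b0]|/incidence_rel[cj b0]]; last first.
  by rewrite b0 scale0r addr0 big1 // => j _; rewrite cj scale0r.
apply/incidence_rel; split=> // -[[|[|]]] // lti; last first.
  by rewrite -[RHS]b0; apply: eq_bigr => j _; congr (k (_, _)); apply: val_inj.
(* For the star at 0: the cancelling pairs add up to both stars together, and the star at 1 sums to
   zero. *)
have : \sum_j (k (ord0, j) + k (ord_max, j)) = 0 by apply: big1 => j _.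
rewrite big_split /= b0 addr0 => k0; rewrite -[RHS]k0.
by apply: eq_bigr => j _; congr (k (_, _)); apply: val_inj.
Qed.

(** By [K2_vec_rel] the edge vectors satisfy the same relations as the incidence vectors, hence
    represent the same matroid. *)
Lemma has_K2_restriction (T : finType) (v : T -> V) (M : matroid T) :
  indep M =1 vec_indep v -> (forall e, exists y, v y == K2_vec e) ->
  has_restriction M (cycle_matroid K).
Proof.
move=> MP ex; pose g e := xchoose (ex e).
have gE e : v (g e) = K2_vec e by apply/eqP/(xchooseP (ex e)).
have ginj : injective g.
  by move=> e e' eqg; apply: K2_vec_inj; rewrite -!gE eqg.
apply/has_restrictionP; exists g => // B; rewrite MP vec_indep_imset //=.
rewrite acyclicE /=; apply: vec_indep_relP => k; rewrite -K2_vec_rel.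
by under eq_bigr do rewrite /= gE.
Qed.
End K2Restriction.

(** * Counting pairs with a common sum *)

Section Greedy.
Variables (m : nat).
Local Notation V := 'rV['F_2]_m.
Implicit Types (A : {set V}) (d : V).

(** In characteristic 2 this is the union of the pairs in [A] with sum [d], both ends counted; for
    [d = 0] it is [A]. *)
Definition shift_pairs A d : {set V} := [set a in A | a + d \in A].

Lemma card_span_free (s : seq V) : free s -> #|<<s>>%VS| = (2 ^ size s)%N.
Proof. by move=> /eqP fs; rewrite card_vspace card_Fp // fs. Qed.

(** With [t] vectors chosen, the span of [d :: s] has 2^(t+1) elements, too few to cover [A], so one
    more can be picked. *)
Lemma greedy_free A d t : d != 0 -> (2 ^ t < #|A|)%N ->
  exists s : seq V, [/\ size s = t, {subset s <= A} & free (d :: s)].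
Proof.
move=> d0; elim: t => [|t IH] ltA.
  by exists [::]; split=> //; rewrite free_cons span_nil memv0 d0 nil_free.
have [|s [szs sA fs]] := IH; first by apply: leq_trans ltA; rewrite ltnS leq_exp2l.
have /subsetPn[x xA xs] : ~~ (A \subset <<d :: s>>%VS).
  by apply/negP => /subset_leq_card; rewrite leqNgt card_span_free //= szs ltA.
exists (x :: s); split=> [|y|]; first by rewrite /= szs.
  by rewrite inE => /predU1P[->//|/sA].
rewrite (@perm_free _ _ _ (x :: d :: s)); first by rewrite free_cons xs.
by apply/permPl; apply: (perm_catCA [:: d] [:: x] s).
Qed.

(** Count the ordered pairs of [A] by their difference [d] in [W]: [d = 0] contributes at most #|A|,
    every other [d] at most [c]. *)
Lemma card_shift_pairs A (W : {vspace V}) (c : nat) :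
  {subset A <= W} -> (forall d, d != 0 -> (#|shift_pairs A d| <= c)%N) ->
  (#|A| * #|A| <= #|A| + c * 2 ^ \dim W)%N.
Proof.
move=> sAW leK.
have -> : (#|A| * #|A| = \sum_(d in W) #|shift_pairs A d|)%N.
  rewrite -sum_nat_const.
  have -> : (\sum_(d in W) #|shift_pairs A d| =
             \sum_(d in W) \sum_(a in A) ((a + d)%R \in A))%N.
    apply: eq_bigr => d _; rewrite -sum1_card -big_mkcondr /=.
    by apply: eq_bigl => a; rewrite inE.
  rewrite exchange_big; apply: eq_bigr => a aA.
  rewrite -big_mkcondr /= sum1_card.
  rewrite -(card_imset (mem A) (addrI (- a))); apply: eq_card => d.
  rewrite unfold_in; apply/imsetP/andP => [[b bA ->]|[dW adA]].
    by rewrite addrA subrr add0r bA memvD ?memvN ?sAW.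
  by exists (a + d); rewrite // addKr.
rewrite (bigD1 0) ?mem0v //= leq_add //.
  by apply/subset_leq_card/subsetP => a; rewrite inE => /andP[].
apply: leq_trans (_ : \sum_(d in W) c <= _)%N.
  rewrite [leqRHS](bigD1 0) ?mem0v //= -[leqLHS]add0n leq_add //.
  by apply: leq_sum => d /andP[_ /leK].
by rewrite sum_nat_const card_vspace card_Fp // mulnC.
Qed.

End Greedy.

(** [card_shift_pairs] applies with [c] = 2^t and [W] the span of the representation: for nonzero
    [d], a larger [shift_pairs] would yield $K_{2,t}$ by [greedy_free]. *)
Lemma card_sq_le_of_no_K2 (t n : nat) (T : finType) (M : matroid T) :
  simple_matroid M -> binary_matroid M -> matroid_rank M = n ->
  ~ has_restriction M (cycle_matroid (complete_bipartite 2 t)) ->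
  (#|T| * #|T| <= #|T| + 2 ^ t * 2 ^ n)%N.
Proof.
move=> sM /binary_matroidP[m [v MP]] rM noK.
have [vinj vn0] := simple_vec_indepP MP sM.
pose A := v @: [set: T].
rewrite -rM (rank_vector_matroid MP) -cardsT -(card_imset _ vinj).
apply: card_shift_pairs => [_ /imsetP[x _ ->]|d d0].
  by apply/memv_span/codom_f.
rewrite leqNgt; apply/negP => /(greedy_free d0)[s [szs sA fs]].
case: noK; pose x (j : 'I_t) : 'rV['F_2]_m := s`_j.
apply: (@has_K2_restriction t _ x d _ _ v) => // [c b cb|[[[|[|]]] // i j]].
- have b0 : b = 0.
    (* Were [b] nonzero, the relation would put [d] in the span of [s]. *)
    apply/eqP; apply: contraTT fs => b0; rewrite free_cons negb_and negbK.
    apply/orP; left.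
    have -> : d = b^-1 *: (b *: d) by rewrite scalerA mulVf // scale1r.
    rewrite memvZ // -(addr0_eq cb) memvN memv_suml // => j _.
    by rewrite memvZ // memv_span // mem_nth ?szs.
  split=> // j; move: cb; rewrite b0 scale0r addr0.
  move: fs; rewrite free_cons => /andP[_ fs].
  have szt : size s == t by rewrite szs.
  move=> cb; exact: (freeP (X := Tuple szt) fs c cb).
- have: x j \in shift_pairs A d by rewrite sA // mem_nth ?szs.
  rewrite inE => /andP[/imsetP[y _ yE] _]; exists y.
  by rewrite /K2_vec /= -yE scale0r addr0.
- have: x j \in shift_pairs A d by rewrite sA // mem_nth ?szs.
  rewrite inE => /andP[_ /imsetP[y _ yE]]; exists y.
  by rewrite /K2_vec /= -yE scale1r.
Qed.

(** * The lower bound *)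

(** If x+y+z = 0, the cubes sum to 3xyz; if x+y+z+w = 0, they sum to -3(x+y)(x+z)(y+z). As 3 = 1 in
    characteristic 2, a zero entry or a repetition follows. *)
Lemma cube_sum_indep (F : fieldType) (s : seq F) :
  2 \in [pchar F] -> uniq s -> 0 \notin s -> (size s <= 4)%N ->
  \sum_(x <- s) x = 0 -> \sum_(x <- s) x ^+ 3 = 0 -> s = [::].
Proof.
move=> ch2; have add0 (a b : F) : a + b = 0 -> a = b.
  by move/addr0_eq => <-; rewrite (oppr_pchar2 ch2).
have n3 : (3 : F) != 0 by rewrite (natrD _ 2 1) (pcharf0 ch2) add0r oner_eq0.
case: s => [|x [|y [|z [|w [|]]]]] //; rewrite !inE !big_cons !big_nil ?addr0.
- by move=> _ x0 _ xE; rewrite xE eqxx in x0.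
- by move=> + _ _ /add0 xy; rewrite xy /= inE eqxx.
- move=> _; rewrite !negb_or => /and3P[x0 y0 z0] _ s1 s3; exfalso.
  have zE : z = - (x + y) by rewrite -[LHS]addr0 -oppr0 -s1; ring.
  have /eqP : 3 * (x * y * z) = 0 by rewrite -[RHS]s3 zE; ring.
  by rewrite !mulf_eq0 (negPf n3) eq_sym (negPf x0) eq_sym (negPf y0) eq_sym (negPf z0).
- rewrite /= !inE !negb_or => /and4P[/and3P[xy xz _] /andP[yz _] _ _] _ _ s1 s3.
  exfalso.
  have wE : w = - (x + y + z) by rewrite -[LHS]addr0 -oppr0 -s1; ring.
  have /eqP : 3 * ((x + y) * (x + z) * (y + z)) = 0.
    by rewrite -[RHS]oppr0 -s3 wE; ring.
  rewrite !mulf_eq0 (negPf n3) /= => /orP[/orP[]|] /eqP/add0 /eqP; exact/negP.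
Qed.

(** * Sets whose subsets of size at most four are independent *)

Section FourIndependent.
Variable m : nat.
Local Notation V := 'rV['F_2]_m.
Implicit Types A B : {set V}.

(** Boolean, so that [maxset] applies. Sizes below four are included: sizes one and two make the
    matroid simple. *)
Definition four_indep A : bool :=
  [forall B : {set V}, (B \subset A) && (#|B| <= 4)%N ==> vec_indep (id : V -> V) B].

Lemma four_indepP A :
  reflect (forall B, B \subset A -> (#|B| <= 4)%N -> vec_indep (id : V -> V) B)
          (four_indep A).
Proof.
apply: (iffP forallP) => iA B; last by apply/implyP => /andP[]; apply: iA.
by move=> sBA cB; have := iA B; rewrite sBA cB.
Qed.

(** If [x] is outside the span of [A], putting it back into an independent [B :\ x] keeps
    independence, so [x |: A] would contradict maximality. *)
Lemma four_indep_maximal_spans A x :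
  maxset four_indep A -> x \in <<enum A>>%VS.
Proof.
move=> /maxsetP[/four_indepP iA maxA]; apply/negPn/negP => xA.
suff /maxA : four_indep (x |: A).
  by move=> /(_ (subsetUr _ _)) eA; case/negP: xA; rewrite memv_span // mem_enum -eA setU11.
apply/four_indepP => B sBA cB.
have sB'A : B :\ x \subset A by rewrite subDset.
have iB' : vec_indep (id : V -> V) (B :\ x).
  by apply: iA => //; apply: leq_trans cB; apply/subset_leq_card/subsetDl.
have [xB|xB] := boolP (x \in B); last first.
  apply: iA => //; apply/subsetP => y yB; have := subsetP sBA y yB.
  by rewrite !inE => /predU1P[yx|//]; rewrite -yx yB in xB.
rewrite -(setD1K xB); apply: vec_indepU1 => //; apply: contra xA.
by apply/subvP/sub_span => _ /imageP[y yB ->]; rewrite mem_enum (subsetP sB'A).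
Qed.

Lemma four_indep_vec_indep (T : finType) (v : T -> V) (B : {set T}) :
  injective v -> four_indep (v @: [set: T]) -> (#|B| <= 4)%N -> vec_indep v B.
Proof.
move=> vinj /four_indepP iA cB; rewrite -(vec_indep_imset (id : V -> V) B vinj).
by apply: iA; rewrite ?card_imset // imsetS ?subsetT.
Qed.

(** Enlarging [A] to a maximal set makes the rank exactly [m], and independence of four-element sets
    excludes the 4-cycles of $K_{2,t}$. *)
Lemma four_indep_witness A t : (2 <= t)%N -> four_indep A ->
  exists2 q, (#|A| <= q)%N & ex2_witness (cycle_matroid (complete_bipartite 2 t)) m q.
Proof.
move=> lt1t /maxset_exists[{}A' maxA' sAA']; exists #|A'|; first exact: subset_leq_card.
pose T : finType := {x : V | x \in A'}; pose v : T -> V := val.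
have iv (B : {set T}) : (#|B| <= 4)%N -> vec_indep v B.
  apply: four_indep_vec_indep; first exact: val_inj.
  rewrite (_ : _ @: _ = A'); first by case/maxsetP: maxA'.
  apply/setP => x; apply/imsetP/idP => [[y _ ->]|xA]; first exact: valP.
  by exists (exist _ x xA).
exists T, (vector_matroid v); split.
- split=> [x|x y _].
    by rewrite /is_loop negbK; apply: iv; rewrite cards1.
  by rewrite /are_parallel !negb_and !negbK [X in [|| _, _ | X]]iv ?orbT // cards2; case: eqP.
- by exists T, m, v, id; [exists id|move=> B; rewrite imset_id].
- suff spanE : <<codom v>>%VS = fullv.
    by rewrite (@rank_vector_matroid _ _ _ v) // spanE dimvf /dim /= mul1n.
  apply/eqP; rewrite eqEsubv subvf; apply/subvP => x _.
  have := four_indep_maximal_spans x maxA'; apply/subvP/sub_span => y.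
  by rewrite mem_enum => yA; apply/codomP; exists (exist _ y yA).
- move=> /has_restrictionP[g ginj gK].
  pose j0 : 'I_t := Ordinal (ltnW lt1t); pose j1 : 'I_t := Ordinal lt1t.
  (* The edges of the 4-cycle through the right vertices [j0] and [j1]. *)
  pose B : {set edge (complete_bipartite 2 t)} := setX [set: 'I_2] [set j0; j1].
  have cB : #|B| = 4 by rewrite cardsX cardsT card_ord cards2.
  have : vec_indep v (g @: B) by apply: iv; rewrite card_imset ?cB.
  rewrite [vec_indep _ _](gK B) /= acyclicE => /vec_indepP/(_ (fun=> 1)).
  have -> : \sum_(e in B) 1 *: @incidence (complete_bipartite 2 t) e =
            \sum_e (e \in B)%:R *: incidence e.
    by rewrite big_mkcond; apply: eq_bigr => e _; case: ifP; rewrite ?scale0r.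
  have F2_2 : 1 + 1 = 0 :> 'F_2 by apply: val_inj.
  (* Every vertex meets zero or two edges of [B], so the incidence vectors of [B] sum to zero. *)
  have rel0 : \sum_e (e \in B)%:R *: @incidence (complete_bipartite 2 t) e = 0.
    apply/incidence_rel; split=> [j|i].
      by rewrite !in_setX !in_setT /=; case: (_ \in _); rewrite ?addr0.
    transitivity (\sum_(j in [set j0; j1]) (1 : 'F_2)).
      by rewrite [RHS]big_mkcond; apply: eq_bigr => j _; rewrite in_setX in_setT /=; case: ifP.
    by rewrite big_setU1 ?inE // big_set1.
  move=> /(_ rel0 (ord0, j0)); rewrite in_setX in_setT !inE eqxx => /(_ isT) /eqP.
  by rewrite oner_eq0.
- by rewrite card_sig; apply: eq_card.
Qed.

(** A relation over GF(2) is a vanishing sum over a subset. As [f] is additive and injective, it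
    pulls back to vanishing sums of x and of x^3 over the set [D] below, which [cube_sum_indep]
    shows to be empty. *)
Lemma four_indep_cube (F : finFieldType) (f : F * F -> V) :
  2 \in [pchar F] -> {morph f : x y / x + y} -> injective f ->
  four_indep [set f (x, x ^+ 3) | x : F in [set~ 0]].
Proof.
move=> ch2 fD finj; pose h (x : F) := f (x, x ^+ 3).
have hinj : injective h by move=> x y /finj[].
apply/four_indepP => B /subsetP sB cB; apply/vec_indepP => k k0 b bB.
apply/eqP/negPn/negP => kb.
pose D := [set x | (h x \in B) && (k (h x) != 0)].
have f0 : f 0 = 0 by apply: (addrI (f 0)); rewrite -fD !addr0.
have sumD : \sum_(x in D) h x = 0.
  rewrite -[RHS]k0 (bigID (fun y => k y != 0)) /= [X in _ + X]big1 ?addr0; last first.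
    by move=> y /andP[_ /negPn/eqP->]; rewrite scale0r.
  rewrite -(big_imset id (in2W hinj)) /=; apply: eq_big => [y|y].
    apply/imsetP/andP => [[x]|[yB ky]]; first by rewrite inE => /andP[? ?] ->.
    by have /imsetP[x _ yE] := sB _ yB; exists x; rewrite // inE /h -yE yB.
  move=> /imsetP[x]; rewrite inE => /andP[_ kx] ->.
  rewrite (_ : k (h x) = 1) ?scale1r //.
  by case: (k (h x)) kx => [[|[|]]] // i _; apply: val_inj.
have [s1 s3] : \sum_(x in D) x = 0 /\ \sum_(x in D) x ^+ 3 = 0.
  have : f (\sum_(x in D) x, \sum_(x in D) x ^+ 3) = f 0.
    rewrite f0 -sumD; apply: (big_ind3 (fun x y z => f (x, y) = z)) => //.
    by move=> x1 x2 y1 y2 z1 z2 <- <-; rewrite -fD.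
  by move/finj => [].
have /imsetP[x xn0 bE] := sB _ bB.
suff D0 : enum D = [::].
  have xD : x \in enum D by rewrite mem_enum inE /h -bE bB.
  by rewrite D0 in xD.
apply: (cube_sum_indep ch2 (enum_uniq _)); rewrite ?big_enum //.
  rewrite mem_enum inE negb_and; apply/orP; left; apply/negP => /sB/imsetP[y].
  by rewrite !inE => y0 /hinj/esym/eqP; rewrite (negPf y0).
rewrite -cardE -(card_imset _ hinj); apply: leq_trans cB.
by apply/subset_leq_card/subsetP => _ /imsetP[y + ->]; rewrite inE => /andP[].
Qed.

End FourIndependent.

(** * The field of order 2^k and its square inside GF(2)^n *)

Import VectorInternalTheory.
Lemma exists_F2_embedding (k n : nat) : (0 < k)%N -> (k + k <= n)%N ->
  exists (F : finFieldType) (f : F * F -> 'rV['F_2]_n),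
  [/\ 2 \in [pchar F], #|F| = (2 ^ k)%N, {morph f : x y / x + y} & injective f].
Proof.
move=> k0 kn; have [F ch2 cF] := @pPrimePowerField 2 k isT k0.
pose L : vectType 'F_2 := pPrimeCharType ch2.
have dL : dim L = k.
  by rewrite -dimvf pprimeChar_dimf cF pfactorK.
(* The coordinates of both components side by side, padded with zeros to length [n]. *)
pose f (u : F * F) : 'rV['F_2]_n :=
  row_mx (v2r (u.1 : L)) (v2r (u.2 : L)) *m pid_mx (dim L + dim L).
exists F, f; split=> //.
  by move=> [a b] [c d]; rewrite /f -mulmxDl add_row_mx -!linearD.
have pid_free : row_free (pid_mx (dim L + dim L) : 'M['F_2]_(dim L + dim L, n)).
  by rewrite /row_free rank_pid_mx ?dL.
by move=> [a b] [c d] /(row_free_inj pid_free)/eq_row_mx[/v2r_inj/= -> /v2r_inj/= ->].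
Qed.

(** With k = [n./2], the curve (x, x^3) has 2^k - 1 points with nonzero x, whence [q.+1]. *)
Lemma ex2_witness_pow_half (t n : nat) : (2 <= t)%N -> (6 <= n)%N ->
  exists2 q, (2 ^ n./2 <= q.+1)%N &
    ex2_witness (cycle_matroid (complete_bipartite 2 t)) n q.
Proof.
move=> lt1t n6.
have k0 : (0 < n./2)%N by rewrite half_gt0 (leq_trans _ n6).
have kn : (n./2 + n./2 <= n)%N by rewrite addnn -[leqRHS]odd_double_half leq_addl.
have [F [f [ch2 cF fD finj]]] := exists_F2_embedding k0 kn.
have [q qA wq] := four_indep_witness lt1t (four_indep_cube ch2 fD finj).
rewrite -ltnS in qA; exists q => //; rewrite -cF; apply: leq_trans qA.
rewrite card_imset => [|x y /finj[] //].
by rewrite cardsC1; case: #|F|.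
Qed.

(** Otherwise x - 1 > pr because r >= 1, so x(x - 1) > (pr)^2 >= p r^2. *)
Lemma le_of_mul_self_le (R : realFieldType) (x p r : R) :
  1 <= p -> 1 <= r -> x * x <= x + p * r ^+ 2 -> x <= (p + 1) * r.
Proof.
move=> p1 r1 xx; rewrite leNgt; apply/negP => ltx.
have pr0 : 0 <= p * r by rewrite mulr_ge0 ?(le_trans ler01).
have prx : p * r < x - 1 by rewrite mulrDl mul1r in ltx; lra.
have : (p * r) * (p * r) < x * (x - 1) by rewrite mulrC ltr_pM //; lra.
have : p * r ^+ 2 <= (p * r) * (p * r).
  by rewrite mulrACA -expr2 ler_wpM2r ?sqr_ge0 // ler_peMr // (le_trans ler01).
rewrite mulrBr mulr1; lra.
Qed.

Theorem theorem1p8 (R : realType) (t : nat) (ht : (2 <= t)%N) :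
  exists c C : R, [/\ 0 < c, 0 < C &
    forall n : nat, (6 <= n)%N ->
      c * 2 `^ (n%:R / 2)
        <= (ex2 (cycle_matroid (complete_bipartite 2 t)) n)%:R
        <= C * 2 `^ (n%:R / 2)].
Proof.
(* In 1/4, one factor 1/2 pays for rounding n/2 down and one for the missing point x = 0; the upper
   constant is p + 1 in [le_of_mul_self_le] with p = 2^t. *)
exists (4^-1), (2 ^+ t + 1); split; rewrite ?invr_gt0 //.
  by rewrite addr_gt0 ?exprn_gt0.
move=> n n6; have [q kq wq] := ex2_witness_pow_half ht n6.
set N := cycle_matroid _ in wq *.
(* The witness for the lower bound also shows that [ex2] is a true maximum and not the default 0. *)
have [wex maxex] := ex2_max wq.
have qex := maxex q wq; move: (ex2 N n) wex qex => e [T [M [sM bM rM noK <-]]] qe.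
set r := 2 `^ _.
have r2 : r ^+ 2 = 2 ^+ n.
  by rewrite -powR_mulrn ?powR_ge0 // -powRrM divfK ?pnatr_eq0 // powR_mulrn.
have r1 : 1 <= r.
  by rewrite -[leLHS](powRr0 2) ler_powR ?ler1n // divr_ge0.
apply/andP; split.
  have rk : r <= 2 * 2 ^+ n./2.
    rewrite -exprS -powR_mulrn // ler_powR ?ler1n // ler_pdivrMr //.
    rewrite -natrM ler_nat muln2 -[leqLHS]odd_double_half doubleS.
    by case: (odd n); rewrite ?add1n ?add0n ?leqnSn // ltnW.
  have ck : (2 ^+ n./2 : R) <= #|T|%:R + 1.
    by rewrite natr1 -(natrX R 2) ler_nat (leq_trans kq).
  (* This absorbs the 1 in [ck]: 2^k - 1 is at least half of 2^k. *)
  have c8 : (2 : R) <= 2 ^+ n./2.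
    by rewrite -[leLHS]expr1 ler_weXn2l ?ler1n // half_gt0 (leq_trans _ n6).
  lra.
have := card_sq_le_of_no_K2 sM bM rM noK.
rewrite -(ler_nat R) natrD !natrM !natrX -r2 => le_sq.
have t0 : 1 <= 2 ^+ t :> R by rewrite exprn_ege1 ?ler1n.
exact: le_of_mul_self_le le_sq.
Qed.
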